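(* Let $\lambda,q\in\mathbb C^*$, $\alpha,a,b\in\mathbb C$, $\beta,\gamma\in\mathbb C^2$, and $\mathbf h(\alpha)\in\mathcal T_\alpha$. Then: (1) The formulas defining $\Omega(\lambda,\alpha,\beta,\gamma,\mathbf h(\alpha))$ make $\mathbb C[t,s]$ into a $\mathcal B(q)$-module which is free of rank one as a $U(\mathfrak h)$-module, where $\mathfrak h=\mathbb CL_{0,0}\oplus\mathbb CW_{0,0}$. (2) If $q=\frac1n$ with $n\in\mathbb Z_+$, then for every $\mathbf h(0)\in\mathcal T_0$ the formulas defining $\Omega_n(\lambda,a,b,\mathbf h(0))$ make $\mathbb C[t,s]$ into a $\mathcal B(\frac1n)$-module which is free of rank one as a $U(\mathfrak h)$-module.
   Context: $\mathbb N=\{0,1,2,\dots\}$, $\mathbb Z_+=\{1,2,\dots\}$, $\mathbb C^*=\mathbb C\setminus\{0\}$. For $q\in\mathbb C^*$, the Takiff Block type Lie algebra $\mathcal B(q)$ is the complex Lie algebra with basis $\{L_{m,i},W_{m,i},C_1,C_2\mid (m,i)\in\mathbb Z\times\mathbb N\}$, with $C_1,C_2$ central and $[L_{m,i},L_{n,j}]=(n(i+q)-m(j+q))L_{m+n,i+j}+\frac{m^3-m}{12}\delta_{i+j,0}\delta_{m+n,0}C_1$, $[L_{m,i},W_{n,j}]=(n(i+q)-m(j+q))W_{m+n,i+j}+\frac{m^3-m}{12}\delta_{i+j,0}\delta_{m+n,0}C_2$, $[W_{m,i},W_{n,j}]=0$. For $k\in\mathbb N$, $n\in\mathbb Z$,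 $\alpha\in\mathbb C$ put $h_{n,k;\alpha}(t)=nt^k-n(n-1)\alpha\frac{t^k-\alpha^k}{t-\alpha}\in\mathbb C[t]$. $\mathcal T_\alpha$ is the set of all families $\mathbf h=\{h_m(t)\mid m\in\mathbb Z\}$ of polynomials of the form $h_m(t)=\sum_{i\ge0}\xi_ih_{m,i;\alpha}(t)$ with $\xi_i\in\mathbb C$ independent of $m$ and all but finitely many zero. For $\mathbf h\in\mathcal T_\alpha$ and $c\in\mathbb C$ put $\Theta_{\mathbf h,c}(t)=c\,\frac{h_1(-t)-h_1(\alpha)}{-t-\alpha}\in\mathbb C[t]$. For $\beta=(\beta_1,\beta_2)$, $\gamma=(\gamma_1,\gamma_2)$, $\mathbf h(\alpha)=\{h_m\}\in\mathcal T_\alpha$, $\Omega(\lambda,\alpha,\beta,\gamma,\mathbf h(\alpha))$ is $\mathbb C[t,s]$ with $C_1,C_2$ acting by $0$ and, for $(m,i)\in\mathbb Z\times\mathbb N$, $L_{m,i}f(t,s)=\delta_{i,0}\lambda^m(s+qh_m(q^{-1}t))f(t,s-mq)-\delta_{i,0}m\lambda^mq(t-mq\alpha)\frac{\partial}{\partial t}f(t,s-mq)+\delta_{m,0}\delta_{i,-2q}\gamma_2f(t,s)+\delta_{i,1}\delta_{q,-1}\lambda^m\big(\beta_2+m\Theta_{\mathbf h,\beta_1}(t)+m\beta_1\frac{\partial}{\partial t}\big)f(t,s+m)$, $W_{m,i}f(t,s)=\delta_{i,0}\lambda^m(t-mq\alpha)f(t,s-mq)+\delta_{m,0}\delta_{i,-2q}\gamma_1f(t,s)+\delta_{i,1}\delta_{q,-1}\beta_1\lambda^mf(t,s+m)$.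 For $q=\frac1n$ and $\mathbf h(0)=\{h_m\}\in\mathcal T_0$, $\Omega_n(\lambda,a,b,\mathbf h(0))$ is $\mathbb C[t,s]$ with $C_1,C_2$ acting by $0$ and, for $(m,i)\in\mathbb Z\times\mathbb N$, $L_{m,i}f(t,s)=\lambda^ma^it^{in}\big((1+in)s+\frac1nh_m(nt)-mi\big)f(t,s-\frac mn)+ib\lambda^ma^{i-1}t^{1+in}f(t,s-\frac mn)-\frac mn\lambda^ma^it^{1+in}\frac{\partial}{\partial t}f(t,s-\frac mn)$, $W_{m,i}f(t,s)=\lambda^ma^it^{1+in}f(t,s-\frac mn)$, with the conventions $a^0=1$ (also for $a=0$) and $iba^{i-1}=0$ for $i=0$. *)

(* Defs.v *)
From HB Require Import structures.
From mathcomp Require Import all_boot all_order all_algebra.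
From mathcomp Require Import zify ring.
From mathcomp Require Import reals complex.
From mathcomp Require Import freeg mpoly.

Set Implicit Arguments.
Unset Strict Implicit.
Unset Printing Implicit Defensive.

Import GRing.Theory.
Local Open Scope ring_scope.

HB.mixin Record isLieAlgebra (K : fieldType) L of GRing.Lmodule K L := {
  lie : L -> L -> L;
  lie_linearl : forall (c : K) (x y z : L),
    lie (c *: x + y) z = c *: lie x z + lie y z;
  lie_linearr : forall (c : K) (x y z : L),
    lie z (c *: x + y) = c *: lie z x + lie z y;
  lie_alt : forall x : L, lie x x = 0;
  lie_jacobi : forall x y z : L,
    lie x (lie y z) + lie y (lie z x) + lie z (lie x y) = 0
}.

#[short(type="lieAlgType")]
HB.structure Definition LieAlgebra (K : fieldType) :=
  {L of isLieAlgebra K L & GRing.Lmodule K L}.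

Section LieGeneral.

Variables (K : fieldType) (L : lieAlgType K).

Definition is_lie_module (V : lmodType K) (rho : L -> V -> V) : Prop :=
  [/\ forall (c : K) (x y : L) (v : V),
        rho (c *: x + y) v = c *: rho x v + rho y v,
      forall (c : K) (x : L) (u v : V),
        rho x (c *: u + v) = c *: rho x u + rho x v
    & forall (x y : L) (v : V),
        rho (lie x y) v = rho x (rho y v) - rho y (rho x v)].

Definition is_lie_subalgebra (S : L -> Prop) : Prop :=
  [/\ S 0,
      forall (c : K) (x y : L), S x -> S y -> S (c *: x + y)
    & forall x y : L, S x -> S y -> S (lie x y)].

(* A linear map from a subalgebra S to an associative algebra is represented
   by a function on L of which only the values on S matter. *)
Definition lie_hom_on (S : L -> Prop) (A : algType K) (f : L -> A) : Prop :=
  (forall (c : K) (x y : L), S x -> S y -> f (c *: x + y) = c *: f x + f y) /\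
  (forall x y : L, S x -> S y -> f (lie x y) = f x * f y - f y * f x).

Definition is_enveloping (S : L -> Prop) (U : algType K) (iota : L -> U) :
    Prop :=
  lie_hom_on S iota /\
  forall (A : algType K) (phi : L -> A), lie_hom_on S phi ->
    exists2 f : {lrmorphism U -> A},
      forall x, S x -> f (iota x) = phi x
    & forall g : {lrmorphism U -> A},
        (forall x, S x -> g (iota x) = phi x) -> g =1 f.

Definition is_alg_module (U : algType K) (V : lmodType K) (act : U -> V -> V) :
    Prop :=
  [/\ forall (c : K) (a b : U) (v : V),
        act (c *: a + b) v = c *: act a v + act b v,
      forall (c : K) (a : U) (u v : V),
        act a (c *: u + v) = c *: act a u + act a v,
      forall v : V, act 1 v = v
    & forall (a b : U) (v : V), act (a * b) v = act a (act b v)].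

(* The U(S)-module structure below is unique: an enveloping algebra of S is
   generated by the image of S. *)
Definition free_rank_one_over_U (S : L -> Prop) (V : lmodType K)
    (rho : L -> V -> V) : Prop :=
  forall (U : algType K) (iota : L -> U), is_enveloping S iota ->
    exists act : U -> V -> V,
      [/\ is_alg_module act,
          forall (x : L) (v : V), S x -> act (iota x) v = rho x v
        & exists v : V, bijective (fun u : U => act u v)].

End LieGeneral.

Inductive block_basis : Type :=
  | bL of int & nat
  | bW of int & nat
  | bC1
  | bC2.

Section BlockBasisChoice.

Let T := ((int * nat) + (int * nat) + bool)%type.

Let enc (b : block_basis) : T :=
  match b with
  | bL m i => inl (inl (m, i))
  | bW m i => inl (inr (m, i))
  | bC1 => inr true
  | bC2 => inr false
  end.

Let dec (t : T) : block_basis :=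
  match t with
  | inl (inl (m, i)) => bL m i
  | inl (inr (m, i)) => bW m i
  | inr true => bC1
  | inr false => bC2
  end.

Let encK : cancel enc dec. Proof. by case. Qed.

HB.instance Definition _ := Countable.copy block_basis (can_type encK).

End BlockBasisChoice.

Section FreeModule.

Variables (K : fieldType) (I : choiceType) (V : lmodType K).

Lemma fgliftE (F : I -> V) (x : {freeg I / K}) :
  fglift F x = \sum_(z <- dom x) coeff z x *: F z.
Proof.
rewrite -{1}[x]freeg_sumE.
have h0 : fglift F 0 = 0 by rewrite -freeg_nil fglift_Freeg prelift_nil.
have hD : {morph fglift F : a b / a + b}.
  move=> a b; have hB := lift_is_additive F.
  have hN c : fglift F (- c) = - fglift F c.
    by rewrite -(sub0r c) hB h0 sub0r.
  by rewrite -{1}(opprK b) hB hN opprK.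
by rewrite (big_morph _ hD h0); apply: eq_bigr => z _; rewrite liftU.
Qed.

Lemma fglift_linear (F : I -> V) c (x y : {freeg I / K}) :
  fglift F (c *: x + y) = c *: fglift F x + fglift F y.
Proof.
have hB := lift_is_additive F.
have h0 : fglift F 0 = 0 by rewrite -freeg_nil fglift_Freeg prelift_nil.
have hN a : fglift F (- a) = - fglift F a by rewrite -(sub0r a) hB h0 sub0r.
rewrite -{1}(opprK y) hB hN opprK; congr (_ + _).
have [->|c0] := eqVneq c 0; first by rewrite !scale0r h0.
rewrite !fgliftE scaler_sumr (perm_big (dom x)) /=.
  by apply: eq_bigr => z _; rewrite coeffZ scalerA.
by rewrite uniq_perm ?uniq_dom //; exact: domZ.
Qed.

Lemma fglift_linearf c (F G : I -> V) (x : {freeg I / K}) :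
  fglift (fun z => c *: F z + G z) x = c *: fglift F x + fglift G x.
Proof.
rewrite !fgliftE scaler_sumr -big_split /=; apply: eq_bigr => z _.
by rewrite scalerDr !scalerA mulrC.
Qed.

Lemma freeg_ext0 (F : {freeg I / K} -> V) :
  (forall c x y, F (c *: x + y) = c *: F x + F y) ->
  (forall z, F << z >> = 0) -> forall x, F x = 0.
Proof.
move=> hF h x.
have h0 : F 0 = 0 by have := hF (-1) 0 0; rewrite !scaleN1r !addNr => ->.
rewrite -[x]freeg_sumE; elim: (dom x) => [|z s IH]; first by rewrite big_nil.
rewrite big_cons.
have -> : << coeff z x *g z >> = coeff z x *: << z >> :> {freeg I / K}.
  by apply/eqP/freeg_eqP => k; rewrite coeffZ !coeffU mul1r.
by rewrite hF h IH scaler0 addr0.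
Qed.

End FreeModule.

Definition takiff_block (K : fieldType) (q : K) : Type := {freeg block_basis / K}.

Section TakiffBlock.

Variables (K : fieldType) (q : K).

Local Notation B := {freeg block_basis / K}.

HB.instance Definition _ := GRing.Lmodule.copy (takiff_block q) B.

Definition bcoef (m : int) (i : nat) (n : int) (j : nat) : K :=
  n%:~R * (i%:R + q) - m%:~R * (j%:R + q).

Definition bcocycle (m : int) (i : nat) (n : int) (j : nat) : K :=
  (m%:~R ^+ 3 - m%:~R) / 12%:R * ((i + j == 0)%N)%:R * (m + n == 0)%:R.

Definition lie_basis (a b : block_basis) : B :=
  match a, b with
  | bL m i, bL n j =>
      bcoef m i n j *: << bL (m + n) (i + j) >> + bcocycle m i n j *: << bC1 >>
  | bL m i, bW n j =>
      bcoef m i n j *: << bW (m + n) (i + j) >> + bcocycle m i n j *: << bC2 >>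
  | bW m i, bL n j =>
      - (bcoef n j m i *: << bW (n + m) (j + i) >> +
         bcocycle n j m i *: << bC2 >>)
  | _, _ => 0
  end.

Definition takiff_lie (x y : B) : B :=
  fglift (fun a => fglift (lie_basis a) y) x.

Lemma takiff_lieU a b : takiff_lie << a >> << b >> = lie_basis a b.
Proof. by rewrite /takiff_lie !liftU !scale1r. Qed.

Let lieDl c x y z :
  takiff_lie (c *: x + y) z = c *: takiff_lie x z + takiff_lie y z.
Proof. exact: fglift_linear. Qed.

Let lieDr c x y z :
  takiff_lie z (c *: x + y) = c *: takiff_lie z x + takiff_lie z y.
Proof.
rewrite /takiff_lie -fglift_linearf !fgliftE; apply: eq_bigr => a _.
by rewrite fglift_linear.
Qed.

Let addl x y z : takiff_lie (x + y) z = takiff_lie x z + takiff_lie y z.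
Proof. by have := lieDl 1 x y z; rewrite !scale1r. Qed.
Let addr x y z : takiff_lie z (x + y) = takiff_lie z x + takiff_lie z y.
Proof. by have := lieDr 1 x y z; rewrite !scale1r. Qed.
Let lie0l z : takiff_lie 0 z = 0.
Proof. by have := lieDl (-1) 0 0 z; rewrite !scaleN1r !addNr. Qed.
Let lie0r z : takiff_lie z 0 = 0.
Proof. by have := lieDr (-1) 0 0 z; rewrite !scaleN1r !addNr. Qed.
Let scalel c x z : takiff_lie (c *: x) z = c *: takiff_lie x z.
Proof. by have := lieDl c x 0 z; rewrite lie0l !addr0. Qed.
Let scaler c x z : takiff_lie z (c *: x) = c *: takiff_lie z x.
Proof. by have := lieDr c x 0 z; rewrite lie0r !addr0. Qed.
Let oppl x z : takiff_lie (- x) z = - takiff_lie x z.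
Proof. by rewrite -scaleN1r scalel scaleN1r. Qed.
Let oppr x z : takiff_lie z (- x) = - takiff_lie z x.
Proof. by rewrite -scaleN1r scaler scaleN1r. Qed.

Let bcoefC m i n j : bcoef n j m i = - bcoef m i n j.
Proof. by rewrite /bcoef; ring. Qed.

Let bcocycleC m i n j : bcocycle n j m i = - bcocycle m i n j.
Proof.
rewrite /bcocycle [(j + i)%N]addnC [n + m]addrC.
case: (eqVneq (m + n) 0) => [/eqP|]; last by rewrite !mulr0 oppr0.
by rewrite addr_eq0 => /eqP ->; rewrite rmorphN /=; ring.
Qed.

Let lie_basisC a b : lie_basis a b = - lie_basis b a.
Proof.
case: a b => [m i|m i||] [n j|n j||] //=; rewrite ?oppr0 ?opprK //.
rewrite bcoefC bcocycleC [n + m]addrC [(j + i)%N]addnC.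
by rewrite !scaleNr opprD.
Qed.

Let lie_basisN a : lie_basis a a = 0.
Proof.
case: a => [m i|m i||] //=.
have -> : bcoef m i m i = 0 by rewrite /bcoef subrr.
rewrite scale0r add0r /bcocycle.
case: (eqVneq (m + m) 0) => [h|]; last by rewrite mulr0 scale0r.
have -> : m = 0 by lia.
by rewrite expr0n /= subr0 !mul0r scale0r.
Qed.

Let lieC x y : takiff_lie x y + takiff_lie y x = 0.
Proof.
move: x; apply: freeg_ext0 => [c x z|a].
  by rewrite lieDl lieDr scalerDr addrACA.
move: y; apply: freeg_ext0 => [c x z|b].
  by rewrite lieDl lieDr scalerDr addrACA.
by rewrite !takiff_lieU lie_basisC addNr.
Qed.

Let lie_altP x : takiff_lie x x = 0.
Proof.
rewrite -[x]freeg_sumE; elim: (dom x) => [|z s IH].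
  by rewrite big_nil lie0l.
rewrite big_cons.
have -> : << coeff z x *g z >> = coeff z x *: << z >> :> B.
  by apply/eqP/freeg_eqP => k; rewrite coeffZ !coeffU mul1r.
rewrite addl !addr IH addr0 scalel scaler takiff_lieU lie_basisN !scaler0 add0r.
exact: lieC.
Qed.

Let bcoef_jacobi m i n j p k :
  bcoef n j p k * bcoef m i (n + p) (j + k) +
  bcoef p k m i * bcoef n j (p + m) (k + i) +
  bcoef m i n j * bcoef p k (m + n) (i + j) = 0.
Proof. by rewrite /bcoef !intrD !natrD; ring. Qed.

Let bcocycle_jacobi m i n j p k :
  bcoef n j p k * bcocycle m i (n + p) (j + k) +
  bcoef p k m i * bcocycle n j (p + m) (k + i) +
  bcoef m i n j * bcocycle p k (m + n) (i + j) = 0.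
Proof.
rewrite /bcocycle.
have -> : n + (p + m) = m + (n + p) by ring.
have -> : p + (m + n) = m + (n + p) by ring.
have -> : (j + (k + i) = i + (j + k))%N by lia.
have -> : (k + (i + j) = i + (j + k))%N by lia.
case: (eqVneq (m + (n + p)) 0) => [hs|]; last by rewrite !mulr0 !addr0.
case: (eqVneq (i + (j + k))%N 0%N) => [ht|]; last first.
  by rewrite !(mulr0, mul0r) !addr0.
have [-> [-> ->]] : i = 0%N /\ j = 0%N /\ k = 0%N by lia.
have -> : p = - (m + n) by lia.
by rewrite /bcoef !(rmorphD, rmorphN) /=; ring.
Qed.

Let comb3 (V : lmodType K) (u v : V) (a1 a2 a3 b1 b2 b3 : K) :
  a1 + a2 + a3 = 0 -> b1 + b2 + b3 = 0 ->
  (a1 *: u + b1 *: v) + (a2 *: u + b2 *: v) + (a3 *: u + b3 *: v) = 0.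
Proof.
move=> ha hb; rewrite (addrACA (a1 *: u)) (addrACA (a1 *: u + a2 *: u)).
by rewrite -!scalerDl ha hb !scale0r addr0.
Qed.

Let jacobi_LLL m i n j p k :
  takiff_lie << bL m i >> (lie_basis (bL n j) (bL p k)) +
  takiff_lie << bL n j >> (lie_basis (bL p k) (bL m i)) +
  takiff_lie << bL p k >> (lie_basis (bL m i) (bL n j)) = 0.
Proof.
rewrite /= !(addr, scaler) !takiff_lieU /= !scaler0 !addr0.
have -> : n + (p + m) = m + (n + p) by ring.
have -> : p + (m + n) = m + (n + p) by ring.
have -> : (j + (k + i) = i + (j + k))%N by lia.
have -> : (k + (i + j) = i + (j + k))%N by lia.
by rewrite !scalerDr !scalerA; apply: comb3.
Qed.

Let lie_basisWL m i n j : lie_basis (bW m i) (bL n j) =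
  bcoef m i n j *: << bW (m + n) (i + j) >> + bcocycle m i n j *: << bC2 >>.
Proof.
rewrite /= [n + m]addrC [(j + i)%N]addnC.
by rewrite (bcoefC n) (bcocycleC n) !scaleNr opprD.
Qed.

Let jacobi_LLW m i n j p k :
  takiff_lie << bL m i >> (lie_basis (bL n j) (bW p k)) +
  takiff_lie << bL n j >> (lie_basis (bW p k) (bL m i)) +
  takiff_lie << bW p k >> (lie_basis (bL m i) (bL n j)) = 0.
Proof.
rewrite lie_basisWL ![lie_basis (bL _ _) _]/=.
rewrite !(addr, scaler) !takiff_lieU lie_basisWL /= !scaler0 !addr0.
have -> : n + (p + m) = m + (n + p) by ring.
have -> : p + (m + n) = m + (n + p) by ring.
have -> : (j + (k + i) = i + (j + k))%N by lia.
have -> : (k + (i + j) = i + (j + k))%N by lia.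
by rewrite !scalerDr !scalerA; apply: comb3.
Qed.

Let jacobi_basis a b c :
  takiff_lie << a >> (takiff_lie << b >> << c >>) +
  takiff_lie << b >> (takiff_lie << c >> << a >>) +
  takiff_lie << c >> (takiff_lie << a >> << b >>) = 0.
Proof.
rewrite !takiff_lieU.
case: a b c => [m i|m i||] [n j|n j||] [p k|p k||];
  lazymatch goal with
  | |- takiff_lie << bL _ _ >> (lie_basis (bL _ _) (bL _ _)) + _ + _ = _ =>
      exact: jacobi_LLL
  | |- takiff_lie << bL _ _ >> (lie_basis (bL _ _) (bW _ _)) + _ + _ = _ =>
      exact: jacobi_LLW
  | |- takiff_lie << bL _ _ >> (lie_basis (bW _ _) (bL _ _)) + _ + _ = _ =>
      rewrite addrC addrA; exact: jacobi_LLW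
  | |- takiff_lie << bW _ _ >> (lie_basis (bL _ _) (bL _ _)) + _ + _ = _ =>
      rewrite -addrA addrC; exact: jacobi_LLW
  | |- _ => rewrite /= ?(lie0r, addr, oppr, scaler) ?takiff_lieU /=
                    ?(scaler0, addr0, oppr0) //
  end.
Qed.

Let lin3 (V : lmodType K) (c : K) (a b d a' b' d' : V) :
  (c *: a + a') + (c *: b + b') + (c *: d + d') =
  c *: (a + b + d) + (a' + b' + d').
Proof.
by rewrite !scalerDr (addrACA (c *: a)) (addrACA (c *: a + c *: b)).
Qed.

Let jacobi x y z :
  takiff_lie x (takiff_lie y z) + takiff_lie y (takiff_lie z x) +
  takiff_lie z (takiff_lie x y) = 0.
Proof.
move: x; apply: freeg_ext0 => [c u v|a].
  by rewrite !(lieDl, lieDr) lin3.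
move: y; apply: freeg_ext0 => [c u v|b].
  by rewrite !(lieDl, lieDr) lin3.
move: z; apply: freeg_ext0 => [c u v|d].
  by rewrite !(lieDl, lieDr) lin3.
exact: jacobi_basis.
Qed.

HB.instance Definition _ := isLieAlgebra.Build K (takiff_block q)
  lieDl lieDr lie_altP jacobi.

End TakiffBlock.

Section TakiffModules.

Variable K : fieldType.

Definition Lgen (q : K) (m : int) (i : nat) : takiff_block q := << bL m i >>.
Definition Wgen (q : K) (m : int) (i : nat) : takiff_block q := << bW m i >>.

Definition toral (q : K) (x : takiff_block q) : Prop :=
  exists a b : K, x = a *: Lgen q 0 0 + b *: Wgen q 0 0.

Definition hpoly (alpha : K) (k : nat) (n : int) : {poly K} :=
  n%:~R *: 'X^k -
  (n%:~R * (n%:~R - 1) * alpha) *: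
    (('X^k - (alpha ^+ k)%:P) %/ ('X - alpha%:P)).

Definition in_T (alpha : K) (h : int -> {poly K}) : Prop :=
  exists (d : nat) (xi : nat -> K),
    forall m : int, h m = \sum_(k < d) xi k *: hpoly alpha k m.

Definition Theta (alpha : K) (h : int -> {poly K}) (c : K) : {poly K} :=
  c *: ((h 1 \Po (- 'X) - (h 1).[alpha]%:P) %/ (- 'X - alpha%:P)).

Definition vt : {mpoly K[2]} := 'X_0.
Definition vs : {mpoly K[2]} := 'X_1.

(* f(t, s + c) *)
Definition shift_s (c : K) (f : {mpoly K[2]}) : {mpoly K[2]} :=
  f \mPo [tuple vt; vs + c%:MP].

Definition dt (f : {mpoly K[2]}) : {mpoly K[2]} := f^`M(0).

(* p(c t) *)
Definition in_t (p : {poly K}) (c : K) : {mpoly K[2]} := horner_alg (c *: vt) p.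

Definition delta (b : bool) : K := b%:R.

Definition Omega_basis (q lambda alpha : K) (beta gamma : K * K)
    (h : int -> {poly K}) (f : {mpoly K[2]}) (x : block_basis) :
    {mpoly K[2]} :=
  match x with
  | bL m i =>
      let mK : K := m%:~R in
      let f0 := shift_s (- (mK * q)) f in
      let f1 := shift_s mK f in
      (delta (i == 0)%N * lambda ^ m) *: ((vs + q *: in_t (h m) q^-1) * f0)
      - (delta (i == 0)%N * mK * lambda ^ m * q) *:
          ((vt - (mK * q * alpha)%:MP) * dt f0)
      + (delta (m == 0) * delta (i%:R == - (2%:R * q)) * gamma.2) *: f
      + (delta (i == 1)%N * delta (q == -1) * lambda ^ m) *:
          (beta.2 *: f1 + mK *: (in_t (Theta alpha h beta.1) 1 * f1)
           + (mK * beta.1) *: dt f1)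
  | bW m i =>
      let mK : K := m%:~R in
      (delta (i == 0)%N * lambda ^ m) *:
          ((vt - (mK * q * alpha)%:MP) * shift_s (- (mK * q)) f)
      + (delta (m == 0) * delta (i%:R == - (2%:R * q)) * gamma.1) *: f
      + (delta (i == 1)%N * delta (q == -1) * beta.1 * lambda ^ m) *:
          shift_s mK f
  | bC1 | bC2 => 0
  end.

Definition Omega (q lambda alpha : K) (beta gamma : K * K)
    (h : int -> {poly K}) (x : takiff_block q) (f : {mpoly K[2]}) :
    {mpoly K[2]} :=
  fglift (Omega_basis q lambda alpha beta gamma h f) x.

(* The factor i%:R makes the junk value of i.-1 at i = 0 irrelevant. *)
Definition Omega_n_basis (n : nat) (lambda a b : K) (h : int -> {poly K})
    (f : {mpoly K[2]}) (x : block_basis) : {mpoly K[2]} :=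
  match x with
  | bL m i =>
      let mK : K := m%:~R in
      let f0 := shift_s (- (mK / n%:R)) f in
      (lambda ^ m * a ^+ i) *:
          (vt ^+ (i * n) *
           ((1 + i * n)%:R *: vs + n%:R^-1 *: in_t (h m) n%:R
            - (mK * i%:R)%:MP) * f0)
      + (i%:R * b * lambda ^ m * a ^+ i.-1) *: (vt ^+ (1 + i * n) * f0)
      - (mK / n%:R * lambda ^ m * a ^+ i) *: (vt ^+ (1 + i * n) * dt f0)
  | bW m i =>
      let mK : K := m%:~R in
      (lambda ^ m * a ^+ i) *:
          (vt ^+ (1 + i * n) * shift_s (- (mK / n%:R)) f)
  | bC1 | bC2 => 0
  end.

Definition Omega_n (n : nat) (lambda a b : K) (h : int -> {poly K})
    (x : takiff_block (n%:R^-1 : K)) (f : {mpoly K[2]}) : {mpoly K[2]} :=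
  fglift (Omega_n_basis n lambda a b h f) x.

End TakiffModules.

Section ToralEnveloping.

Variables (K : fieldType) (q : K).

Lemma toral_L : toral (Lgen q 0 0).
Proof. by exists 1, 0; rewrite scale1r scale0r addr0. Qed.

Lemma toral_W : toral (Wgen q 0 0).
Proof. by exists 0, 1; rewrite scale1r scale0r add0r. Qed.

Lemma toral_abelian (x y : takiff_block q) : toral x -> toral y -> lie x y = 0.
Proof.
have lieE a b : lie (<< a >> : takiff_block q) << b >> = lie_basis q a b.
  exact: takiff_lieU.
have LW : lie (Lgen q 0 0) (Wgen q 0 0) = 0.
  rewrite [LHS]lieE /= /bcoef /bcocycle !mul0r subrr scale0r add0r.
  by rewrite expr0n subrr !mul0r scale0r.
have WL : lie (Wgen q 0 0) (Lgen q 0 0) = 0.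
  rewrite [LHS]lieE /= /bcoef /bcocycle !mul0r subrr scale0r add0r.
  by rewrite expr0n subrr !mul0r scale0r oppr0.
have l0 (z : takiff_block q) : lie 0 z = 0.
  by have := lie_linearl (-1) 0 0 z; rewrite !scaleN1r !addNr.
have r0 (z : takiff_block q) : lie z 0 = 0.
  by have := lie_linearr (-1) 0 0 z; rewrite !scaleN1r !addNr.
have ls c (u z : takiff_block q) : lie (c *: u) z = c *: lie u z.
  by rewrite -[c *: u]addr0 lie_linearl l0 !addr0.
have rs c (u z : takiff_block q) : lie z (c *: u) = c *: lie z u.
  by rewrite -[c *: u]addr0 lie_linearr r0 !addr0.
move=> [a [b ->]] [c [d ->]].
by rewrite lie_linearl ls !lie_linearr !rs !lie_alt LW WL !(scaler0, addr0).
Qed.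

Lemma toral_subalgebra : is_lie_subalgebra (@toral K q).
Proof.
split=> [|c x y [a1 [b1 ->]] [a2 [b2 ->]]|x y hx hy].
- by exists 0, 0; rewrite !scale0r addr0.
- exists (c * a1 + a2), (c * b1 + b2).
  by rewrite scalerDr !scalerA addrACA !scalerDl.
- by rewrite toral_abelian //; exists 0, 0; rewrite !scale0r addr0.
Qed.

(* U(h) is the polynomial algebra with t = W_{0,0} and s = L_{0,0}. *)
Definition toral_iota (x : takiff_block q) : {mpoly K[2]} :=
  coeff (bL 0 0) x *: vs K + coeff (bW 0 0) x *: vt K.

Lemma toral_iotaE a b :
  toral_iota (a *: Lgen q 0 0 + b *: Wgen q 0 0) = a *: vs K + b *: vt K.
Proof.
rewrite /toral_iota /Lgen /Wgen !coeffD !coeffZ !coeffU /=.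
by rewrite !mulr1 !mulr0 addr0 add0r.
Qed.

Lemma toral_enveloping : is_enveloping (@toral K q) toral_iota.
Proof.
split; first split=> [c x y _ _|x y hx hy].
- rewrite /toral_iota !coeffD !coeffZ !scalerDl scalerDr !scalerA.
  by rewrite addrACA.
- by rewrite toral_abelian // /toral_iota !coeff0 !scale0r addr0 mulrC subrr.
move=> A phi [phiD phiM].
have phi0 : phi 0 = 0.
  have [t0 _ _] := toral_subalgebra.
  by have := phiD (-1) 0 0 t0 t0; rewrite !scaleN1r !addNr.
set a := phi (Lgen q 0 0); set b := phi (Wgen q 0 0).
have ab : GRing.comm b a.
  have := phiM _ _ toral_W toral_L; rewrite toral_abelian ?phi0.
  - by move/esym/eqP; rewrite subr_eq0 => /eqP.
  - exact: toral_W.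
  - exact: toral_L.
have phiE c d : phi (c *: Lgen q 0 0 + d *: Wgen q 0 0) = c *: a + d *: b.
  have [t0 tD _] := toral_subalgebra.
  have tW : toral (d *: Wgen q 0 0).
    by rewrite -[_ *: _]addr0; apply: tD => //; exact: toral_W.
  rewrite phiD //; last exact: toral_L.
  rewrite -[d *: _]addr0 phiD //; last exact: toral_W.
  by rewrite phi0 addr0.
pose g (i : 'I_2) : A := if i == 0 then b else a.
pose f (p : {mpoly K[2]}) : A := mmap (in_alg A) g p.
have g1E m : mmap1 g m = b ^+ m 0 * a ^+ m 1.
  rewrite /mmap1 big_ord_recl big_ord1 /g /=.
  by congr (_ * _ ^+ m _); exact: val_inj.
have g1D m1 m2 : mmap1 g (m1 + m2) = mmap1 g m1 * mmap1 g m2.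
  rewrite !g1E !mnmDE !exprD -!mulrA; congr (_ * _); rewrite !mulrA.
  congr (_ * _); apply: commrX; apply/commr_sym; apply: commrX.
  exact: commr_sym.
have fD c p r : f (c *: p + r) = c *: f p + f r.
  by rewrite /f mmapD mmapZ /= mulr_algl.
have f0 : f 0 = 0 by rewrite /f mmap0.
have fZ c p : f (c *: p) = c *: f p by rewrite -[c *: p]addr0 fD f0 addr0.
have fX m : f 'X_[m] = mmap1 g m by rewrite /f mmapX.
have f_sum (s : seq 'X_{1..2}) (F : 'X_{1..2} -> {mpoly K[2]}) :
    f (\sum_(m <- s) F m) = \sum_(m <- s) f (F m).
  by apply: big_morph => // p r; rewrite /f mmapD.
have fM p r : f (p * r) = f p * f r.
  rewrite [p in LHS]mpolyE mulr_suml f_sum.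
  rewrite [p in RHS]mpolyE f_sum mulr_suml; apply: eq_bigr => m _.
  rewrite -scalerAl !fZ -scalerAl; congr (_ *: _).
  rewrite [r in LHS]mpolyE mulr_sumr f_sum.
  rewrite [r in RHS]mpolyE f_sum mulr_sumr; apply: eq_bigr => m' _.
  by rewrite -scalerAr !fZ -scalerAr -mpolyXD !fX g1D.
have f1 : f 1 = 1 by rewrite -mpolyX0 fX g1E !mnm0E !expr0 mulr1.
pose F : {lrmorphism {mpoly K[2]} -> A} := HB.pack f
  (GRing.isLinear.Build K {mpoly K[2]} A *:%R f fD)
  (GRing.isMonoidMorphism.Build {mpoly K[2]} A f (f1, fM)).
have Fs : f (vs K) = a by rewrite fX mmap1U.
have Ft : f (vt K) = b by rewrite fX mmap1U.
exists F => [x [c [d ->]]|G hG p].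
  by rewrite toral_iotaE phiE /= fD fZ Fs Ft.
have Gs : G (vs K) = a.
  have := hG _ toral_L; rewrite -[X in toral_iota X]scale1r.
  rewrite -[X in toral_iota X]addr0 -[X in _ + X](scale0r (Wgen q 0 0)).
  by rewrite toral_iotaE scale1r scale0r addr0.
have Gt : G (vt K) = b.
  have := hG _ toral_W; rewrite -[X in toral_iota X]scale1r.
  rewrite -[X in toral_iota X]add0r -[X in X + _](scale0r (Lgen q 0 0)).
  by rewrite toral_iotaE scale1r scale0r add0r.
rewrite [p]mpolyE /= f_sum raddf_sum; apply: eq_bigr => m _.
rewrite [LHS](linearZ_LR G) fZ fX g1E; congr (_ *: _).
rewrite mpolyXE_id big_ord_recl big_ord1 rmorphM !rmorphXn.
have -> : fintype.lift ord0 ord0 = 1 :> 'I_2 by exact: val_inj.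
by congr (_ ^+ _ * _ ^+ _); [exact: Gt | exact: Gs].
Qed.

End ToralEnveloping.

(* Main.v *)
(** In both modules every basis vector of degree m acts by an operator
    f |-> p * f(t, s - mq) + r * d/dt f(t, s - mq) + g * f, with p in K[t, s],
    r in K[t] and g in K; at q = -1 the shift f(t, s + m) of the terms with
    i = 1 is the same f(t, s - mq).  Commutators of such operators are again
    of this form, so the bracket relations become polynomial identities for p
    and r.  They are computable because a family in T_alpha has the shape
    h_m = m ((t - m alpha) G + c) with G in K[t] and c in K independent of m;
    in particular Theta_{h,c'}(t) = c' G(-t).  The scalars g are supported on
    degrees where [B, B] has no component.  Freeness holds because L_{0,0} and
    W_{0,0} act as multiplication by s and t. *)

From HB Require Import structures.
Require Import Defs.
From mathcomp Require Import all_boot all_order all_algebra.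
From mathcomp Require Import ring.
From mathcomp Require Import reals complex.
From mathcomp Require Import freeg mpoly.

Set Implicit Arguments.
Unset Strict Implicit.
Unset Printing Implicit Defensive.

Import GRing.Theory.
Local Open Scope ring_scope.

(** * Linear extension, and Lie modules given on a basis *)

HB.instance Definition _ (K : fieldType) (I : choiceType) (V : lmodType K)
  (G : I -> V) :=
  GRing.isLinear.Build K {freeg I / K} V *:%R (fglift G) (fglift_linear G).

Lemma fglift_gen (K : fieldType) (I : choiceType) (V : lmodType K)
  (G : I -> V) i : fglift G << i >> = G i.
Proof. by rewrite liftU scale1r. Qed.

Lemma eq_fglift (K : fieldType) (I : choiceType) (V : lmodType K)
  (F G : I -> V) : F =1 G -> fglift F =1 fglift G.
Proof. by move=> e x; rewrite !fgliftE; apply: eq_bigr => z _; rewrite e. Qed.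

Lemma eq_is_lie_module (K : fieldType) (L : lieAlgType K) (V : lmodType K)
    (rho rho' : L -> V -> V) :
  rho =2 rho' -> is_lie_module rho' -> is_lie_module rho.
Proof.
by move=> e [h1 h2 h3]; split=> *; rewrite !e ?h1 ?h2 ?h3.
Qed.

Section LieModuleOnBasis.

Variables (K : fieldType) (q : K) (V : lmodType K) (F : V -> block_basis -> V).

Let rho (x : {freeg block_basis / K}) v := fglift (F v) x.

(** The defect of the bracket relation is linear in each of its two Lie arguments, so it vanishes as
    soon as it does on pairs of basis elements. *)
Lemma lie_module_on_basis :
  (forall b c u v, F (c *: u + v) b = c *: F u b + F v b) ->
  (forall a b v, rho (lie_basis q a b) v = F (F v b) a - F (F v a) b) ->
  is_lie_module (rho : takiff_block q -> V -> V).
Proof.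
move=> Flin Flie.
have rhoDr c x u v : rho x (c *: u + v) = c *: rho x u + rho x v.
  rewrite /rho -fglift_linearf !fgliftE.
  by apply: eq_bigr => b _; rewrite Flin.
have rhoDl c x y v : rho (c *: x + y) v = c *: rho x v + rho y v.
  exact: fglift_linear.
have comb c (A B A' B' C C' : V) :
  c *: C + C' - (c *: A + A' - (c *: B + B')) =
  c *: (C - (A - B)) + (C' - (A' - B')).
  by rewrite !scalerBr [- (c *: B + _)]opprD (addrACA (c *: A)) opprD addrACA.
split=> // x y v; apply/eqP; rewrite -subr_eq0; apply/eqP.
pose D (x y : takiff_block q) : V :=
  rho (lie x y) v - (rho x (rho y v) - rho y (rho x v)).
rewrite -[LHS]/(D x y).
move: x; apply: freeg_ext0 => [c x z|a].
  rewrite /D.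
  rewrite (lie_linearl (s := takiff_block q)) !rhoDl !rhoDr.
  exact: comb.
move: y; apply: freeg_ext0 => [c x z|b].
  rewrite /D (lie_linearr (s := takiff_block q)) !rhoDl !rhoDr.
  exact: comb.
rewrite /D.
have -> : lie (<< a >> : takiff_block q) << b >> = lie_basis q a b.
  exact: takiff_lieU.
by rewrite Flie /rho !fglift_gen subrr.
Qed.

End LieModuleOnBasis.

(** [F], [F1], [F2] stand for a shifted polynomial and its first two t-derivatives, [p1] and [p'1]
    for shifted coefficients. The second-order terms [r * r' * F2] of the two compositions
    cancel. *)
Lemma first_order_commutator (A : comNzRingType)
    (p p1 p' p'1 r r' dp1 dp'1 dr dr' F F1 F2 : A) :
  p * (p'1 * F + r' * F1)
    + r * (dp'1 * F + p'1 * F1 + (dr' * F1 + r' * F2))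
  - (p' * (p1 * F + r * F1)
     + r' * (dp1 * F + p1 * F1 + (dr * F1 + r * F2))) =
  (p * p'1 - p' * p1 + r * dp'1 - r' * dp1) * F
  + (p * r' + r * p'1 + r * dr' - (p' * r + r' * p1 + r' * dr)) * F1.
Proof. by ring. Qed.

(** * Shifts and derivations of K[t, s] *)

Section ShiftOperators.

Variable K : fieldType.
Implicit Types (c d : K) (f g p r : {mpoly K[2]}).

Lemma mpoly2_ind (P : {mpoly K[2]} -> Prop) :
  (forall c, P c%:MP) -> (forall f g, P f -> P g -> P (f + g)) ->
  (forall f, P f -> P (vt K * f)) -> (forall f, P f -> P (vs K * f)) ->
  forall f, P f.
Proof.
move=> PC PD Pt Ps f; rewrite [f]mpolyE.
apply: (big_ind P) => [|//|m _]; first by rewrite -mpolyC0.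
(* The coefficient moves behind t^i s^j, so that the two inductions peel off the powers of t, then
   those of s, and end at a constant. *)
rewrite mpolyXE_id big_ord_recl big_ord1 -mul_mpolyC mulrC -mulrA.
have -> : fintype.lift ord0 ord0 = 1 :> 'I_2 by exact: val_inj.
elim: (m _) => [|k IH]; last by rewrite exprS -mulrA; apply: Pt.
rewrite mul1r; elim: (m _) => [|k IH]; first by rewrite mul1r.
by rewrite exprS -mulrA; apply: Ps.
Qed.

Lemma shift_sC c d : shift_s c d%:MP = d%:MP.
Proof. exact: comp_mpolyC. Qed.

Lemma shift_st c : shift_s c (vt K) = vt K.
Proof. by rewrite /shift_s comp_mpolyXU. Qed.

Lemma shift_ss c : shift_s c (vs K) = vs K + c%:MP.
Proof. by rewrite /shift_s comp_mpolyXU. Qed.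

Lemma shift_sD c f g : shift_s c (f + g) = shift_s c f + shift_s c g.
Proof. exact: comp_mpolyD. Qed.

Lemma shift_sZ c d f : shift_s c (d *: f) = d *: shift_s c f.
Proof. exact: comp_mpolyZ. Qed.

Lemma shift_sM c f g : shift_s c (f * g) = shift_s c f * shift_s c g.
Proof. exact: rmorphM. Qed.

Lemma shift_sX c f k : shift_s c (f ^+ k) = shift_s c f ^+ k.
Proof. exact: rmorphXn. Qed.

Lemma shift_sN c f : shift_s c (- f) = - shift_s c f.
Proof. exact: comp_mpolyN. Qed.

Lemma shift_s_int c (m : int) : shift_s c (m%:~R : {mpoly K[2]}) = m%:~R.
Proof. exact: rmorph_int. Qed.

Lemma shift_s_zero c : shift_s c 0 = 0 :> {mpoly K[2]}.
Proof. exact: rmorph0. Qed.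

Lemma shift_s0 (f : {mpoly K[2]}) : shift_s 0 f = f.
Proof.
elim/mpoly2_ind: f => [a|f g hf hg|f hf|f hf].
- by rewrite shift_sC.
- by rewrite !shift_sD hf hg.
- by rewrite !shift_sM hf shift_st.
- by rewrite !shift_sM hf shift_ss mpolyC0 addr0.
Qed.

Lemma shift_s_comp c d f : shift_s c (shift_s d f) = shift_s (c + d) f.
Proof.
elim/mpoly2_ind: f => [a|f g hf hg|f hf|f hf].
- by rewrite !shift_sC.
- by rewrite !shift_sD hf hg.
- by rewrite !shift_sM hf !shift_st.
- by rewrite !shift_sM hf !shift_ss shift_sD shift_sC shift_ss mpolyCD addrA.
Qed.

Lemma dtC c : dt c%:MP = 0 :> {mpoly K[2]}.
Proof. exact: mderivC. Qed.

Lemma dtD f g : dt (f + g) = dt f + dt g.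
Proof. exact: mderivD. Qed.

Lemma dtZ c f : dt (c *: f) = c *: dt f.
Proof. exact: mderivZ. Qed.

Lemma dtM f g : dt (f * g) = dt f * g + f * dt g.
Proof. exact: mderivM. Qed.

Lemma dtN f : dt (- f) = - dt f.
Proof. exact: mderivN. Qed.

Lemma dt0 : dt 0 = 0 :> {mpoly K[2]}.
Proof. exact: mderiv0. Qed.

Lemma dt_int (m : int) : dt (m%:~R : {mpoly K[2]}) = 0.
Proof. by rewrite -[m%:~R](rmorph_int (@mpolyC 2 K)) dtC. Qed.

Lemma dt_t : dt (vt K) = 1.
Proof.
by rewrite /dt mderivX mnm1E eqxx scale1r -mpolyX0; congr 'X_[_];
   apply/mnmP => i; rewrite mnmBE subnn mnm0E.
Qed.

Lemma dt_s : dt (vs K) = 0.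
Proof. by rewrite /dt mderivX mnm1E scale0r. Qed.

(** The factor t keeps the exponent at [k] and avoids a truncated predecessor; [del_tau] needs this
    Euler form. *)
Lemma dt_tX k : vt K * dt (vt K ^+ k) = k%:R * vt K ^+ k.
Proof.
elim: k => [|k IH]; first by rewrite expr0 mul0r -mpolyC1 dtC mulr0.
rewrite exprS dtM dt_t mulrDr [X in _ + X]mulrCA IH -[k.+1]addn1 natrD; ring.
Qed.

Lemma dt_shift_s c f : dt (shift_s c f) = shift_s c (dt f).
Proof.
elim/mpoly2_ind: f => [a|f g hf hg|f hf|f hf].
- by rewrite shift_sC !dtC -mpolyC0 shift_sC.
- by rewrite !shift_sD !dtD hf hg shift_sD.
- rewrite shift_sM !dtM hf shift_sD !shift_sM !shift_st !dt_t.
  by rewrite -mpolyC1 shift_sC.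
- rewrite shift_sM !dtM hf shift_sD !shift_sM !shift_ss dtD !dt_s dtC.
  by rewrite -mpolyC0 shift_sC addr0.
Qed.

Lemma in_t_shift_s c d (P : {poly K}) : shift_s c (in_t P d) = in_t P d.
Proof.
rewrite /in_t; elim/poly_ind: P => [|P a IH].
  by rewrite rmorph0 -mpolyC0 shift_sC.
rewrite rmorphD rmorphM /= horner_algX horner_algC.
rewrite shift_sD shift_sM IH !shift_sZ shift_st -mpolyC1.
by rewrite shift_sC.
Qed.

Definition diffop p r c f := p * shift_s c f + r * dt (shift_s c f).

Lemma diffop_linear p r c a f g :
  diffop p r c (a *: f + g) = a *: diffop p r c f + diffop p r c g.
Proof.
by rewrite /diffop shift_sD shift_sZ dtD dtZ !mulrDr -!scalerAr addrACA
  -scalerDr.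
Qed.

(** The shift fixes [r'] and commutes with d/dt, so it passes through the inner operator; the
    Leibniz rule does the rest. *)
Lemma diffop_comp p r c p' r' d f : shift_s c r' = r' ->
  diffop p r c (diffop p' r' d f) =
  let F := shift_s (c + d) f in
  p * (shift_s c p' * F + r' * dt F)
  + r * (dt (shift_s c p') * F + shift_s c p' * dt F
         + (dt r' * dt F + r' * dt (dt F))).
Proof.
move=> hr; have sE : shift_s c (diffop p' r' d f) =
    shift_s c p' * shift_s (c + d) f + r' * dt (shift_s (c + d) f).
  by rewrite shift_sD !shift_sM hr -dt_shift_s shift_s_comp.
by rewrite {1}/diffop sE dtD !dtM.
Qed.

Lemma diffop_commutator p r c p' r' d f :
  shift_s c r' = r' -> shift_s d r = r ->
  diffop p r c (diffop p' r' d f) - diffop p' r' d (diffop p r c f) =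
  diffop (p * shift_s c p' - p' * shift_s d p
          + r * dt (shift_s c p') - r' * dt (shift_s d p))
    (p * r' + r * shift_s c p' + r * dt r'
     - (p' * r + r' * shift_s d p + r' * dt r)) (c + d) f.
Proof.
move=> hr' hr; rewrite !diffop_comp // [d + c]addrC /diffop.
exact: first_order_commutator.
Qed.

End ShiftOperators.

(** * Modules given by first-order operators *)

Section FirstOrderModule.

Variables (K : fieldType) (q : K).
Variables (PL QL PW : int -> nat -> {mpoly K[2]}) (gL gW : int -> nat -> K).

Definition first_order_action (f : {mpoly K[2]}) (x : block_basis) :=
  match x with
  | bL m i => diffop (PL m i) (QL m i) (- (m%:~R * q)) f + gL m i *: f
  | bW m i => diffop (PW m i) 0 (- (m%:~R * q)) f + gW m i *: f
  | bC1 | bC2 => 0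
  end.

Let sh (m : int) := @shift_s K (- (m%:~R * q)).

Hypothesis shQ : forall c m i, shift_s c (QL m i) = QL m i.
Hypothesis shW : forall c m i, shift_s c (PW m i) = PW m i.
Hypothesis PLL : forall m i n j,
  (bcoef q m i n j)%:MP * PL (m + n) (i + j) =
  PL m i * sh m (PL n j) - PL n j * sh n (PL m i)
  + QL m i * dt (sh m (PL n j)) - QL n j * dt (sh n (PL m i)).
Hypothesis QLL : forall m i n j,
  (bcoef q m i n j)%:MP * QL (m + n) (i + j) =
  PL m i * QL n j + QL m i * sh m (PL n j) + QL m i * dt (QL n j)
  - (PL n j * QL m i + QL n j * sh n (PL m i) + QL n j * dt (QL m i)).
Hypothesis PLW : forall m i n j,
  (bcoef q m i n j)%:MP * PW (m + n) (i + j) =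
  PL m i * PW n j - PW n j * sh n (PL m i) + QL m i * dt (PW n j).
Hypothesis gLL : forall m i n j,
  bcoef q m i n j * gL (m + n) (i + j) = 0.
Hypothesis gLW : forall m i n j,
  bcoef q m i n j * gW (m + n) (i + j) = 0.

(** Scalars commute with linear operators, so adding them does not change a commutator. *)
Let scalar_commutator (D E : {mpoly K[2]} -> {mpoly K[2]}) c d f :
  (forall a u v, D (a *: u + v) = a *: D u + D v) ->
  (forall a u v, E (a *: u + v) = a *: E u + E v) ->
  D (E f + d *: f) + c *: (E f + d *: f)
  - (E (D f + c *: f) + d *: (D f + c *: f)) = D (E f) - E (D f).
Proof.
have rearr (x y z A B : {mpoly K[2]}) :
    (x + A) + (y + z) - ((y + B) + (x + z)) = A - B.
  rewrite [x + A]addrC [y + B]addrC addrACA opprD [LHS]addrACA subrr addr0.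
  by rewrite opprD [LHS]addrACA subrr addr0.
move=> hD hE; rewrite [E f + _]addrC [D f + _]addrC hD hE !scalerDr !scalerA.
rewrite [d * c]mulrC [_ + c *: E f]addrC [_ + d *: D f]addrC.
exact: rearr.
Qed.

(** The coefficients [P], [R] and the shift [e] enter through equations, so that applying this to a
    concrete bracket leaves exactly the coefficient identities to prove. *)
Let act_pair (p r p' r' P R f : {mpoly K[2]}) c a d b e :
  (forall x, shift_s x r = r) -> (forall x, shift_s x r' = r') ->
  P = p * shift_s c p' - p' * shift_s d p
      + r * dt (shift_s c p') - r' * dt (shift_s d p) ->
  R = p * r' + r * shift_s c p' + r * dt r'
      - (p' * r + r' * shift_s d p + r' * dt r) ->
  e = c + d ->
  diffop P R e f =
  (diffop p r c (diffop p' r' d f + b *: f)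
   + a *: (diffop p' r' d f + b *: f))
  - (diffop p' r' d (diffop p r c f + a *: f)
     + b *: (diffop p r c f + a *: f)).
Proof.
move=> hr hr' -> -> ->.
by rewrite scalar_commutator ?diffop_commutator // => *; exact: diffop_linear.
Qed.

Let shE (m n : int) : - ((m + n)%:~R * q) = - (m%:~R * q) - n%:~R * q.
Proof. by rewrite intrD mulrDl opprD. Qed.

Let diffopZ c d (p r f : {mpoly K[2]}) :
  c *: diffop p r d f = diffop (c%:MP * p) (c%:MP * r) d f.
Proof. by rewrite /diffop -mul_mpolyC mulrDr !mulrA. Qed.

Let diffop0 d (f : {mpoly K[2]}) : diffop 0 0 d f = 0.
Proof. by rewrite /diffop !mul0r addr0. Qed.

(** [PLL], [QLL] and [PLW] compare the coefficients of a commutator with those of the bracket, while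
    [gLL] and [gLW] remove the scalar of the bracket. Central terms contribute nothing because [bC1]
    and [bC2] act by 0. *)
Lemma first_order_lie_module :
  is_lie_module (fun (x : takiff_block q) f => fglift (first_order_action f) x).
Proof.
have act_lin b c u v : first_order_action (c *: u + v) b =
    c *: first_order_action u b + first_order_action v b.
  by case: b => [m i|m i||] /=; rewrite ?scaler0 ?addr0 // diffop_linear
    !scalerDr !scalerA [_ * c]mulrC addrACA.
have act0 b : first_order_action 0 b = 0.
  by have := act_lin b (-1) 0 0; rewrite !scaleN1r !addNr.
have LW m i n j f :
    fglift (first_order_action f) (lie_basis q (bL m i) (bW n j)) =
    first_order_action (first_order_action f (bW n j)) (bL m i)
    - first_order_action (first_order_action f (bL m i)) (bW n j).
  rewrite /= linearD !linearZ /= !fglift_gen /= scaler0 addr0.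
  rewrite scalerDr scalerA gLW scale0r addr0 diffopZ.
  apply: act_pair; rewrite ?shE // => *;
    rewrite ?shift_s_zero // ?PLW ?shW ?mul0r ?subr0 //.
  (* What remains is the coefficient of d/dt, which is [QL * PW - PW * QL]. *)
  by rewrite dt0 !mulr0 !addr0 add0r mulrC subrr.
apply: (lie_module_on_basis act_lin) => -[m i|m i||] [n j|n j||] f;
  rewrite ?(linear0, act0, subr0) //.
- rewrite /= linearD !linearZ /= !fglift_gen /= scaler0 addr0.
  rewrite scalerDr scalerA gLL scale0r addr0 diffopZ.
  by apply: act_pair; rewrite ?shE // ?PLL ?QLL.
(* The bracket of a W with an L is defined as the negative of the opposite one, so [LW] applies. *)
- by rewrite -opprB -LW /= linearN.
(* Two W's have bracket 0, written as the zero operator of the expected shift to fit [act_pair]. *)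
- rewrite -[LHS](diffop0 (- ((m + n)%:~R * q)) f) /=.
  apply: act_pair; rewrite ?shE // => *;
    rewrite ?shift_s_zero // ?shW ?dt0 ?mul0r ?mulr0 ?addr0 ?subr0 //.
  by rewrite mulrC subrr.
Qed.

End FirstOrderModule.

(** * Freeness over U(h) *)

Lemma toral_free_rank_one (K : fieldType) (q : K)
    (rho : takiff_block q -> {mpoly K[2]} -> {mpoly K[2]}) :
  (forall c x y v, rho (c *: x + y) v = c *: rho x v + rho y v) ->
  (forall v, rho (Lgen q 0 0) v = vs K * v) ->
  (forall v, rho (Wgen q 0 0) v = vt K * v) ->
  free_rank_one_over_U (@toral K q) rho.
Proof.
move=> rhoD rhoL rhoW U iota [iota_hom iota_univ].
have [tau_hom tau_univ] := toral_enveloping q.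
have [F Fiota _] := iota_univ _ _ tau_hom.
have [G Gtau _] := tau_univ _ _ iota_hom.
(* Uniqueness in the universal property: [G \o F] and the identity both extend [iota], hence
   coincide. The other composite is treated alike, so every enveloping algebra is isomorphic to
   K[t, s]. *)
have FK : cancel F G.
  have [e _ e_uniq] := iota_univ _ _ iota_hom.
  move=> u; transitivity (e u).
    apply: (e_uniq (G \o F)) => x hx /=; by rewrite Fiota // Gtau.
  by symmetry; apply: (e_uniq idfun).
have GK : cancel G F.
  have [e _ e_uniq] := tau_univ _ _ tau_hom.
  move=> u; transitivity (e u).
    apply: (e_uniq (F \o G)) => x hx /=; by rewrite Gtau // Fiota.
  by symmetry; apply: (e_uniq idfun).
(* The action is multiplication transported along [F], which makes 1 a free generator. *)
exists (fun u v => F u * v); split.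
- split=> [c a b v|c a u v|v|a b v].
  + by rewrite linearP mulrDl scalerAl.
  + by rewrite mulrDr scalerAr.
  + by rewrite rmorph1 mul1r.
  + by rewrite rmorphM mulrA.
- move=> x v hx; rewrite Fiota //; case: hx => [a [b ->]].
  have rho0 : rho 0 v = 0.
    by have := rhoD (-1) 0 0 v; rewrite !scaleN1r !addNr.
  rewrite rhoD -[b *: Wgen q 0 0]addr0 rhoD rho0 addr0 rhoL rhoW addr0.
  by rewrite toral_iotaE mulrDl !scalerAl.
- by exists 1, G => u; rewrite mulr1.
Qed.

(** * Normal form of the families in T_alpha *)

Lemma in_T_normal_form (K : fieldType) (alpha : K) (h : int -> {poly K}) :
  in_T alpha h -> exists (G : {poly K}) (c : K), forall m,
  h m = m%:~R *: (('X - (m%:~R * alpha)%:P) * G + c%:P).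
Proof.
move=> [d [xi hE]].
pose Gk k := ('X^k - (alpha ^+ k)%:P) %/ ('X - alpha%:P).
(* Dividing t^k by t - alpha gives quotient [Gk k] and remainder alpha^k, whence m t^k - m(m-1)
   alpha G_k = m((t - m alpha) G_k + alpha^k). The witnesses combine these with weights [xi k]. *)
exists (\sum_(k < d) xi k *: Gk k), (\sum_(k < d) xi k * alpha ^+ k) => m.
have GkE k : 'X^k = Gk k * ('X - alpha%:P) + (alpha ^+ k)%:P.
  rewrite divpK ?subrK // dvdp_XsubCl rootE !hornerE ?hornerXn.
  by rewrite subrr.
rewrite hE mulr_sumr rmorph_sum -big_split scaler_sumr /=.
apply: eq_bigr => k _; rewrite /hpoly -/(Gk k) {1}GkE rmorphM /=.
rewrite -!mul_polyC !(rmorphM, rmorphB) /=.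
ring.
Qed.

Lemma in_T0 (K : fieldType) (alpha : K) (h : int -> {poly K}) :
  in_T alpha h -> h 0 = 0.
Proof. by move=> /in_T_normal_form[G [c ->]]; rewrite scale0r. Qed.

(** * The modules Omega *)

Section OmegaSymbols.

Variables (K : fieldType) (q lambda alpha c : K) (beta : K * K).
(* H stands for G(q^-1 t), where h_m = m ((t - m alpha) G + c). *)
Variable H : {mpoly K[2]}.
Hypothesis lambda_neq0 : lambda != 0.
Hypothesis shift_H : forall d, shift_s d H = H.

Let t_ (m : int) : {mpoly K[2]} := vt K - (m%:~R * q * alpha)%:MP.

Definition Omega_coefL (m : int) (i : nat) : {mpoly K[2]} :=
  match i with
  | 0%N => (lambda ^ m)%:MP * (vs K + m%:~R * (t_ m * H + (q * c)%:MP))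
  | 1%N => (delta K (q == -1) * lambda ^ m)%:MP *
           (beta.2%:MP + m%:~R * (beta.1%:MP * H))
  | _ => 0
  end.

Definition Omega_dcoefL (m : int) (i : nat) : {mpoly K[2]} :=
  match i with
  | 0%N => - ((m%:~R * lambda ^ m * q)%:MP * t_ m)
  | 1%N => (delta K (q == -1) * lambda ^ m * (m%:~R * beta.1))%:MP
  | _ => 0
  end.

Definition Omega_coefW (m : int) (i : nat) : {mpoly K[2]} :=
  match i with
  | 0%N => (lambda ^ m)%:MP * t_ m
  | 1%N => (delta K (q == -1) * beta.1 * lambda ^ m)%:MP
  | _ => 0
  end.

Definition Omega_scalar (g : K) (m : int) (i : nat) : K :=
  delta K (m == 0) * delta K (i%:R == - (2%:R * q)) * g.

Let shiftE := (shift_sD, shift_sM, shift_sN, shift_st, shift_ss,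
  shift_sC, shift_s_int, shift_H, shift_s_zero).
Let dtE := (dtD, dtM, dtN, dt_t, dt_s, dtC, dt_int, dt0).
Let CE := (mpolyCM, mpolyCD, mpolyCN, rmorph_int (@mpolyC 2 K)).

Lemma Omega_dcoefL_shift d m i : shift_s d (Omega_dcoefL m i) = Omega_dcoefL m i.
Proof. by case: i => [|[|i]]; rewrite /= /t_ !shiftE. Qed.

Lemma Omega_coefW_shift d m i : shift_s d (Omega_coefW m i) = Omega_coefW m i.
Proof. by case: i => [|[|i]]; rewrite /= /t_ !shiftE. Qed.

Let lambdaD m n : lambda ^ (m + n) = lambda ^ m * lambda ^ n.
Proof. exact: expfzDr. Qed.

Let deltaP : q = -1 /\ delta K (q == -1) = 1 \/ delta K (q == -1) = 0.
Proof. by case: eqVneq => [->|_]; [left | right]. Qed.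

(** Only the degrees 0 and 1 carry nonzero coefficients. When i + j = 1 the factor [delta] either
    vanishes or forces q = -1, which is the split made by [deltaP]. *)
Lemma Omega_coefW_bracket m i n j :
  (bcoef q m i n j)%:MP * Omega_coefW (m + n) (i + j) =
  Omega_coefL m i * Omega_coefW n j
  - Omega_coefW n j * shift_s (- (n%:~R * q)) (Omega_coefL m i)
  + Omega_dcoefL m i * dt (Omega_coefW n j).
Proof.
case: i j => [|[|i]] [|[|j]]; rewrite /= ?addn0 ?addn1 ?addnS;
  rewrite /= /t_ /bcoef ?dtE ?shiftE ?lambdaD ?intrD ?CE; try ring;
  case: deltaP => [[-> ->]|->]; rewrite ?CE; ring.
Qed.

(** The derivative [dt H] is left unevaluated: it cancels between the last two terms. *)
Lemma Omega_coefL_bracket m i n j :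
  (bcoef q m i n j)%:MP * Omega_coefL (m + n) (i + j) =
  Omega_coefL m i * shift_s (- (m%:~R * q)) (Omega_coefL n j)
  - Omega_coefL n j * shift_s (- (n%:~R * q)) (Omega_coefL m i)
  + Omega_dcoefL m i * dt (shift_s (- (m%:~R * q)) (Omega_coefL n j))
  - Omega_dcoefL n j * dt (shift_s (- (n%:~R * q)) (Omega_coefL m i)).
Proof.
case: i j => [|[|i]] [|[|j]]; rewrite /= ?addn0 ?addn1 ?addnS;
  rewrite /= /t_ /bcoef ?shiftE ?dtE ?lambdaD ?intrD ?CE; try ring;
  case: deltaP => [[-> ->]|->]; rewrite ?CE; ring.
Qed.

Lemma Omega_dcoefL_bracket m i n j :
  (bcoef q m i n j)%:MP * Omega_dcoefL (m + n) (i + j) =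
  Omega_coefL m i * Omega_dcoefL n j
  + Omega_dcoefL m i * shift_s (- (m%:~R * q)) (Omega_coefL n j)
  + Omega_dcoefL m i * dt (Omega_dcoefL n j)
  - (Omega_coefL n j * Omega_dcoefL m i
     + Omega_dcoefL n j * shift_s (- (n%:~R * q)) (Omega_coefL m i)
     + Omega_dcoefL n j * dt (Omega_dcoefL m i)).
Proof.
case: i j => [|[|i]] [|[|j]]; rewrite /= ?addn0 ?addn1 ?addnS;
  rewrite /= /t_ /bcoef ?shiftE ?dtE ?lambdaD ?intrD ?CE; try ring;
  case: deltaP => [[-> ->]|->]; rewrite ?CE; ring.
Qed.

(** If m + n = 0 and i + j = -2q, then the structure constant is n(i + j + 2q) = 0. *)
Lemma Omega_scalar_bracket g m i n j :
  bcoef q m i n j * Omega_scalar g (m + n) (i + j) = 0.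
Proof.
rewrite /Omega_scalar /bcoef /delta.
case: eqVneq => [mn|_]; last by rewrite !mul0r mulr0.
case: eqVneq => [ij|_]; last by rewrite mulr0 mul0r mulr0.
have -> : m = - n by apply/eqP; rewrite -addr_eq0 mn.
have -> : (j%:R : K) = - (2%:R * q) - i%:R by rewrite -ij natrD addrC addKr.
rewrite rmorphN /=; ring.
Qed.

End OmegaSymbols.

Lemma horner_alg_comp (K : fieldType) (A : algType K) (a : A) (p r : {poly K}) :
  horner_alg a (p \Po r) = horner_alg (horner_alg a r) p.
Proof.
elim/poly_ind: p => [|p c IH]; first by rewrite comp_poly0 !rmorph0.
by rewrite comp_poly_MXaddC !rmorphD !rmorphM /= IH horner_algX !horner_algC.
Qed.

Lemma deltaE (K : fieldType) : ((delta K true = 1) * (delta K false = 0))%type.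
Proof. by []. Qed.

Section OmegaModules.

Variables (K : fieldType) (q lambda alpha : K) (beta gamma : K * K).
Variable h : int -> {poly K}.
Hypotheses (lambda_neq0 : lambda != 0) (q_neq0 : q != 0).
Hypothesis hT : in_T alpha h.

Lemma Omega_lie_module : is_lie_module (@Omega K q lambda alpha beta gamma h).
Proof.
have [G [c hE]] := in_T_normal_form hT.
pose H := in_t G q^-1.
have shH d : shift_s d H = H by exact: in_t_shift_s.
(* With t written as q(q^-1 t), the identity [h1] no longer depends on q q^-1 = 1, so [ring] can
   prove it. *)
have tE : vt K = q%:MP * (q^-1%:MP * vt K).
  by rewrite mulrA -mpolyCM divff // mul1r.
have h1 m : q *: in_t (h m) q^-1 =
    m%:~R * ((vt K - (m%:~R * q * alpha)%:MP) * H + (q * c)%:MP).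
  rewrite /in_t hE linearZ rmorphD rmorphM /= rmorphB /= -/(in_t G _) -/H.
  rewrite horner_algX !horner_algC -!mul_mpolyC mulr1 !mulr1.
  rewrite [vt K in RHS]tE !(mpolyCM, rmorph_int (@mpolyC 2 K)); ring.
(* [H] equals G(-t) only at q = -1, hence the factor [delta] on both sides. The division in [Theta]
   is exact: h_1 = (t - alpha) G + c, so h_1(alpha) = c. *)
have Th : delta K (q == -1) *: in_t (Theta alpha h beta.1) 1 =
    delta K (q == -1) *: (beta.1%:MP * H).
  case: eqVneq => [q1|]; last by rewrite !scale0r.
  congr (_ *: _); have -> : Theta alpha h beta.1 = beta.1 *: (G \Po (- 'X)).
    rewrite /Theta hE mul1r scale1r; congr (_ *: _).
    rewrite comp_polyD comp_polyM comp_polyB comp_polyX !comp_polyC.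
    rewrite hornerD hornerM !hornerE /= subrr mul0r add0r addrK mulKp //.
    by rewrite -opprD oppr_eq0 monic_neq0 ?monicXaddC.
  rewrite /in_t linearZ /= horner_alg_comp rmorphN /= horner_algX mul_mpolyC.
  by rewrite /H /in_t q1 invrN1 scale1r scaleN1r mulr_algl.
have actE f b : Omega_basis q lambda alpha beta gamma h f b =
    first_order_action q (Omega_coefL q lambda alpha c beta H)
      (Omega_dcoefL q lambda alpha beta) (Omega_coefW q lambda alpha beta)
      (Omega_scalar q gamma.2) (Omega_scalar q gamma.1) f b.
  case: b => [m i|m i||] //=.
  - rewrite [LHS]addrAC; congr (_ + _); rewrite /diffop.
    case: i => [|[|i]] /=.
    + rewrite !deltaE !mul0r scale0r addr0 !mul1r h1 mulNr.
      by rewrite -!mul_mpolyC !mulrA.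
    + rewrite !deltaE !mul0r !scale0r subr0 add0r !mul1r.
      move: Th; case: eqVneq => [q1|_]; rewrite !deltaE; last first.
        by rewrite !mul0r !scale0r addr0.
      rewrite !scale1r !mul1r q1 mulrN1 opprK => ->.
      rewrite -!mul_mpolyC !(mpolyCM, rmorph_int (@mpolyC 2 K)).
      by rewrite !mulrDr !mulrDl !mulrA.
    + by rewrite !deltaE !mul0r !scale0r subr0 !addr0.
  - rewrite [LHS]addrAC; congr (_ + _); rewrite /diffop mul0r addr0.
    case: i => [|[|i]] /=.
    + by rewrite !deltaE !mul0r scale0r addr0 !mul1r -!mul_mpolyC mulrA.
    + rewrite !deltaE !mul0r !scale0r add0r !mul1r.
      case: eqVneq => [q1|_]; rewrite !deltaE; last first.
        by rewrite !mul0r scale0r.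
      by rewrite q1 mulrN1 opprK mul_mpolyC.
    + by rewrite !deltaE !mul0r !scale0r addr0.
apply: eq_is_lie_module; last first.
  apply: (first_order_lie_module (Omega_dcoefL_shift q lambda alpha beta)
    (Omega_coefW_shift q lambda alpha beta)
    (Omega_coefL_bracket q alpha c beta lambda_neq0 shH)
    (Omega_dcoefL_bracket q alpha c beta lambda_neq0 shH)
    (Omega_coefW_bracket q alpha c beta lambda_neq0 shH) (Omega_scalar_bracket q gamma.2)
    (Omega_scalar_bracket q gamma.1)).
by move=> x f; apply: eq_fglift.
Qed.

(** Since 2q is nonzero, the [gamma] terms do not occur at i = 0; together with h_0 = 0 this leaves
    multiplication by s and t. *)
Lemma Omega_free : (2%:R : K) != 0 -> free_rank_one_over_U (@toral K q)
   (@Omega K q lambda alpha beta gamma h).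
Proof.
move=> two_neq0; have q2 : (0 == - (2%:R * q)) = false.
  by rewrite eq_sym oppr_eq0 mulf_eq0 (negPf two_neq0) (negPf q_neq0).
apply: toral_free_rank_one => [c x y v|v|v].
- exact: fglift_linear.
- rewrite /Omega fglift_gen /= /delta /= q2 !(mul0r, mulr0, scale0r, addr0).
  rewrite expr0z !mul1r !scale1r subr0 oppr0 shift_s0 (in_T0 hT).
  by rewrite /in_t rmorph0 scaler0 addr0.
- rewrite /Omega fglift_gen /= /delta /= q2 !(mul0r, mulr0, scale0r, addr0).
  by rewrite expr0z !mul1r !scale1r subr0 oppr0 shift_s0.
Qed.

End OmegaModules.

(** * The modules Omega_n *)

Section OmegaNSymbols.

Variables (K : fieldType) (n : nat) (lambda a b : K).
(* T stands for h_m(n t) / (n m), which does not depend on m when alpha = 0. *)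
Variable T : {mpoly K[2]}.
Hypothesis lambda_neq0 : lambda != 0.
Hypothesis n_neq0 : n%:R != 0 :> K.
Hypothesis shift_T : forall d, shift_s d T = T.

(* In terms of S = n s and del = q t d/dt the parameter n disappears: the shift
   by - m q takes S to S - m, and del (tau i) = i (tau i). *)
Let q : K := n%:R^-1.
Let S : {mpoly K[2]} := n%:R%:MP * vs K.
Let tau i : {mpoly K[2]} := vt K ^+ (i * n).
(* The value at a of the derivative of x^i, also for i = 0. *)
Let da i : K := i%:R * a ^+ i.-1.
Let del (f : {mpoly K[2]}) : {mpoly K[2]} := q%:MP * vt K * dt f.

Definition Omega_n_coefL (m : int) (i : nat) : {mpoly K[2]} :=
  (lambda ^ m * a ^+ i)%:MP *
    (tau i * ((i%:R + q)%:MP * S + m%:~R * (T - i%:R%:MP)))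
  + (b * lambda ^ m * da i)%:MP * (vt K * tau i).

Definition Omega_n_dcoefL (m : int) (i : nat) : {mpoly K[2]} :=
  - (m%:~R * lambda ^ m * a ^+ i)%:MP * tau i * (q%:MP * vt K).

Definition Omega_n_coefW (m : int) (i : nat) : {mpoly K[2]} :=
  (lambda ^ m * a ^+ i)%:MP * (vt K * tau i).

Let shift_tau d i : shift_s d (tau i) = tau i.
Proof. by rewrite /tau shift_sX shift_st. Qed.

Let shift_S (m : int) : shift_s (- (m%:~R * q)) S = S - m%:~R.
Proof.
rewrite /S shift_sM shift_sC shift_ss mulrDr -mpolyCM mulrN mulrCA divff //.
by rewrite mulr1 mpolyCN rmorph_int.
Qed.

(** This turns the derivatives in the brackets into [del], for which [S], [tau i] and t are
    eigenvectors. *)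
Let del_QL m i f : Omega_n_dcoefL m i * dt f =
  - (m%:~R * lambda ^ m * a ^+ i)%:MP * tau i * del f.
Proof. by rewrite /Omega_n_dcoefL /del !mulrA. Qed.

Let delD f g : del (f + g) = del f + del g.
Proof. by rewrite /del dtD mulrDr. Qed.

Let delN f : del (- f) = - del f.
Proof. by rewrite /del dtN mulrN. Qed.

Let delM f g : del (f * g) = del f * g + f * del g.
Proof. by rewrite /del dtM mulrDr mulrA [X in _ + X]mulrCA. Qed.

Let delC c : del c%:MP = 0.
Proof. by rewrite /del dtC mulr0. Qed.

Let del_int (m : int) : del m%:~R = 0.
Proof. by rewrite -[m%:~R](rmorph_int (@mpolyC 2 K)) delC. Qed.

Let del_S : del S = 0.
Proof. by rewrite /S delM delC /del dt_s !mulr0 mul0r addr0. Qed.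

Let del_t : del (vt K) = q%:MP * vt K.
Proof. by rewrite /del dt_t mulr1. Qed.

Let del_tau i : del (tau i) = i%:R * tau i.
Proof.
have qn : q%:MP * n%:R = 1 :> {mpoly K[2]}.
  by rewrite -(rmorph_nat (@mpolyC 2 K)) -mpolyCM mulVf.
by rewrite /del /tau -mulrA dt_tX natrM !mulrA [_ * i%:R]mulrC
  -[_ * n%:R]mulrA qn mulr1.
Qed.

Let tauD i j : tau (i + j) = tau i * tau j.
Proof. by rewrite /tau mulnDl exprD. Qed.

(** This is the Leibniz rule for x^i x^j at a; the cases i = 0 and j = 0 are separate because of the
    truncated predecessor. *)
Let daD i j : da (i + j) = da i * a ^+ j + a ^+ i * da j.
Proof.
rewrite /da; case: i j => [|i] [|j];
  rewrite ?addn0 ?add0n ?mul0r ?mulr0 ?addr0 ?add0r ?mulr1 ?mul1r //.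
rewrite natrD addSn /= exprD !exprS; ring.
Qed.

Let lambdaD m k : lambda ^ (m + k) = lambda ^ m * lambda ^ k.
Proof. exact: expfzDr. Qed.

Let shiftE := (shift_sD, shift_sM, shift_sN, shift_tau, shift_S,
  shift_st, shift_sC, shift_s_int, shift_T).
Let delE := (delD, delM, delN, del_tau, del_S, del_t, delC, del_int).
Let CE := (mpolyCM, mpolyCD, mpolyCN, rmorph_int (@mpolyC 2 K),
  rmorph_nat (@mpolyC 2 K)).

Lemma Omega_n_dcoefL_shift d m i : shift_s d (Omega_n_dcoefL m i) = Omega_n_dcoefL m i.
Proof. by rewrite /Omega_n_dcoefL !shiftE. Qed.

Lemma Omega_n_coefW_shift d m i : shift_s d (Omega_n_coefW m i) = Omega_n_coefW m i.
Proof. by rewrite /Omega_n_coefW !shiftE. Qed.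

Lemma Omega_n_coefW_bracket m i k j :
  (bcoef q m i k j)%:MP * Omega_n_coefW (m + k) (i + j) =
  Omega_n_coefL m i * Omega_n_coefW k j
  - Omega_n_coefW k j * shift_s (- (k%:~R * q)) (Omega_n_coefL m i)
  + Omega_n_dcoefL m i * dt (Omega_n_coefW k j).
Proof.
rewrite del_QL /Omega_n_coefW /Omega_n_coefL /bcoef !(shiftE, delE).
rewrite tauD lambdaD exprD !CE; ring.
Qed.

(** The terms linear in b match by [daD]; those quadratic in b, and those with [del T], cancel by
    symmetry. *)
Lemma Omega_n_coefL_bracket m i k j :
  (bcoef q m i k j)%:MP * Omega_n_coefL (m + k) (i + j) =
  Omega_n_coefL m i * shift_s (- (m%:~R * q)) (Omega_n_coefL k j)
  - Omega_n_coefL k j * shift_s (- (k%:~R * q)) (Omega_n_coefL m i)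
  + Omega_n_dcoefL m i * dt (shift_s (- (m%:~R * q)) (Omega_n_coefL k j))
  - Omega_n_dcoefL k j * dt (shift_s (- (k%:~R * q)) (Omega_n_coefL m i)).
Proof.
rewrite !del_QL /Omega_n_coefL /bcoef !(shiftE, delE).
rewrite tauD daD !lambdaD !intrD !natrD !exprD !CE; ring.
Qed.

Lemma Omega_n_dcoefL_bracket m i k j :
  (bcoef q m i k j)%:MP * Omega_n_dcoefL (m + k) (i + j) =
  Omega_n_coefL m i * Omega_n_dcoefL k j
  + Omega_n_dcoefL m i * shift_s (- (m%:~R * q)) (Omega_n_coefL k j)
  + Omega_n_dcoefL m i * dt (Omega_n_dcoefL k j)
  - (Omega_n_coefL k j * Omega_n_dcoefL m i
     + Omega_n_dcoefL k j * shift_s (- (k%:~R * q)) (Omega_n_coefL m i)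
     + Omega_n_dcoefL k j * dt (Omega_n_dcoefL m i)).
Proof.
rewrite !del_QL /Omega_n_coefL /Omega_n_dcoefL /bcoef !(shiftE, delE).
rewrite tauD lambdaD intrD exprD !CE; ring.
Qed.

End OmegaNSymbols.

Section OmegaNModules.

Variables (K : fieldType) (n : nat) (lambda a b : K) (h : int -> {poly K}).
Hypotheses (lambda_neq0 : lambda != 0) (n_neq0 : n%:R != 0 :> K).
Hypothesis hT : in_T 0 h.

Lemma Omega_n_lie_module : is_lie_module (@Omega_n K n lambda a b h).
Proof.
have [G [c hE]] := in_T_normal_form hT.
(* At alpha = 0 the normal form is m(tG + c), linear in m. *)
pose T := n%:R^-1 *: in_t ('X * G + c%:P) n%:R.
have shT d : shift_s d T = T by rewrite /T shift_sZ in_t_shift_s.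
have hTE m : n%:R^-1 *: in_t (h m) n%:R = m%:~R * T.
  rewrite hE mulr0 subr0 -mul_polyC /T /in_t rmorphM /= horner_algC -scalerAr.
  by rewrite -[_%:A]/(in_alg _ _) rmorph_int.
(* This is (1 + in)s = (i + q)S with q = 1/n and S = ns. *)
have sE i : (1 + i * n)%:R *: vs K
    = (i%:R + n%:R^-1)%:MP * (n%:R%:MP * vs K).
  rewrite mulrA -mpolyCM mulrDl mulVf // mul_mpolyC natrD natrM.
  by rewrite addrC.
have actE f x : Omega_n_basis n lambda a b h f x =
    first_order_action n%:R^-1 (Omega_n_coefL n lambda a b T)
      (Omega_n_dcoefL n lambda a) (Omega_n_coefW n lambda a) (fun _ _ => 0)
      (fun _ _ => 0) f x.
  case: x => [m i|m i||] //=; rewrite scale0r addr0 /diffop.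
  - rewrite hTE sE /Omega_n_coefL /Omega_n_dcoefL -!mul_mpolyC exprD expr1.
    rewrite !(mpolyCM, rmorph_int (@mpolyC 2 K), rmorph_nat (@mpolyC 2 K)).
    ring.
  - by rewrite mul0r addr0 /Omega_n_coefW -mul_mpolyC exprD expr1 !mulrA.
apply: eq_is_lie_module; last first.
  apply: (first_order_lie_module (gL := fun _ _ => 0) (gW := fun _ _ => 0)
    (Omega_n_dcoefL_shift n lambda a) (Omega_n_coefW_shift n lambda a)
    (Omega_n_coefL_bracket a b lambda_neq0 n_neq0 shT)
    (Omega_n_dcoefL_bracket a b lambda_neq0 n_neq0 shT)
    (Omega_n_coefW_bracket a b lambda_neq0 n_neq0 shT)) => *; rewrite mulr0 //.
by move=> x f; apply: eq_fglift.
Qed.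

Lemma Omega_n_free :
  free_rank_one_over_U (@toral K n%:R^-1) (@Omega_n K n lambda a b h).
Proof.
apply: toral_free_rank_one => [c x y v|v|v].
- exact: fglift_linear.
- rewrite /Omega_n fglift_gen /= (in_T0 hT) /in_t rmorph0 scaler0 addr0.
  rewrite !mul0r !mul0n !scale0r mpolyC0 !subr0 addr0 oppr0 shift_s0.
  by rewrite expr0z !expr0 !mul1r !scale1r.
- rewrite /Omega_n fglift_gen /= mul0r oppr0 shift_s0.
  by rewrite expr0z !expr0 mul1r scale1r mul0n addn0 expr1.
Qed.

End OmegaNModules.

Theorem proposition3p2 (R : realType) (lambda q alpha a b : R[i])
    (beta gamma : R[i] * R[i]) (h : int -> {poly R[i]})
    (lambda_neq0 : lambda != 0) (q_neq0 : q != 0) (hT : in_T alpha h) :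
  (is_lie_module (@Omega R[i] q lambda alpha beta gamma h) /\
   free_rank_one_over_U (@toral R[i] q)
     (@Omega R[i] q lambda alpha beta gamma h)) /\
  (forall n : nat, (0 < n)%N -> q = n%:R^-1 ->
   forall h0 : int -> {poly R[i]}, in_T 0 h0 ->
   is_lie_module (@Omega_n R[i] n lambda a b h0) /\
   free_rank_one_over_U (@toral R[i] n%:R^-1)
     (@Omega_n R[i] n lambda a b h0)).
Proof.
split.
  split; first exact: Omega_lie_module.
  by apply: Omega_free; rewrite // Num.Theory.pnatr_eq0.
move=> n n_gt0 _ h0 hT0; have n_neq0 : n%:R != 0 :> R[i].
  by rewrite Num.Theory.pnatr_eq0 -lt0n.
by split; [exact: Omega_n_lie_module | exact: Omega_n_free].
Qed.
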